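(* There exist absolute constants $c_1>0$ and $c_2>0$ such that for all integers $d\ge 2$, all integers $n\ge (c_1 d)^{\frac{d-1}{2}}$, and all polytopes $P_n\subset B_2^d$ having $n$ vertices, $$ \mathrm{vol}_d(B_2^d)-\mathrm{vol}_d(P_n)\ \ge\ c_2\, d\, \mathrm{vol}_d(B_2^d)\, n^{-\frac{2}{d-1}} . $$
   Context: $B_2^d$ denotes the closed Euclidean unit ball in $\mathbb{R}^d$ and $\mathrm{vol}_d$ the $d$-dimensional Lebesgue measure. *)

(* Defs.v *)
From HB Require Import structures.
From mathcomp Require Import all_boot all_order all_algebra.
From mathcomp Require Import all_classical all_reals all_analysis.
Set Implicit Arguments. Unset Strict Implicit. Unset Printing Implicit Defensive.
Import Order.TTheory GRing.Theory Num.Theory.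
Local Open Scope classical_set_scope.
Local Open Scope ring_scope.

Definition unit_ball (R : realType) (d : nat) : set 'rV[R]_d :=
  [set x | \sum_(i < d) (x ord0 i) ^+ 2 <= 1].

Definition conv_hull (R : realType) (d : nat) (A : set 'rV[R]_d) : set 'rV[R]_d :=
  [set y | exists (m : nat) (w : 'I_m -> R) (a : 'I_m -> 'rV[R]_d),
      (forall j, A (a j)) /\ (forall j, 0 <= w j) /\ \sum_(j < m) w j = 1 /\
      y = \sum_(j < m) w j *: a j].

Definition is_polytope (R : realType) (d : nat) (P : set 'rV[R]_d) : Prop :=
  exists (m : nat) (p : 'I_m -> 'rV[R]_d), P = conv_hull (range p).

Definition vertices (R : realType) (d : nat) (P : set 'rV[R]_d) : set 'rV[R]_d :=
  [set v | P v /\ ~ (exists (a b : 'rV[R]_d) (t : R), P a /\ P b /\ a != b /\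
             0 < t < 1 /\ v = t *: a + (1 - t) *: b)].

Definition has_n_vertices (R : realType) (d : nat) (P : set 'rV[R]_d) (n : nat) : Prop :=
  exists x : 'I_n -> 'rV[R]_d, injective x /\ range x = vertices P.

Definition box (R : realType) (d : nat) (a b : 'rV[R]_d) : set 'rV[R]_d :=
  [set x | forall i : 'I_d, a ord0 i <= x ord0 i <= b ord0 i].

(* d-dimensional Lebesgue (outer) measure: infimum of the total volume of
   countable covers by closed boxes *)
Definition vol (R : realType) (d : nat) (A : set 'rV[R]_d) : \bar R :=
  ereal_inf [set s : \bar R | exists a b : nat -> 'rV[R]_d,
      (forall k (i : 'I_d), a k ord0 i <= b k ord0 i) /\
      A `<=` \bigcup_k box (a k) (b k) /\
      s = (\sum_(0 <= k <oo) (\prod_(i < d) (b k ord0 i - a k ord0 i))%:E)%E].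

(* Main.v *)
(** Let [x_i] be the vertices of [P] and let [A] be the set of points [y] of
    the ball [B] with [<x_i, y> > (1 - t) |y|] for some [i], where
    [t = n^(-2/(d-1)) / 512].  Each of these [n] cones is covered by few balls
    of radius of order [sqrt t], so [vol A <= vol B / 2].  If [q] in [B \ A]
    has norm above [1 - t/2], then [<p, q> <= max_i <x_i, q> <= (1 - t) |q|] for
    all [p] in [P], so that the set [Q] of such points is at distance at least
    [t/2] from [P], whence [vol P + vol Q <= vol B].  Finally [B \ A] is
    star-shaped and contained in the union of [Q] and [(1 - t/2) (B \ A)],
    hence [vol Q >= (1 - (1 - t/2)^d) vol (B \ A)], which is of order
    [d t vol B].  Only homotheties of sets and the superadditivity of the outer
    measure on separated sets are used, never rotations or polar coordinates. *)
Require Import Defs.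
From HB Require Import structures.
From mathcomp Require Import all_boot all_order all_algebra.
From mathcomp Require Import all_classical all_reals all_analysis.
From mathcomp Require Import ring lra.
Set Implicit Arguments.
Unset Strict Implicit.
Unset Printing Implicit Defensive.
Import Order.TTheory GRing.Theory Num.Theory.
Local Open Scope classical_set_scope.
Local Open Scope ring_scope.

(** * The outer measure by boxes: subadditivity, homotheties, separated sets *)

Definition box_vol (R : realType) (d : nat) (a b : 'rV[R]_d) : R :=
  \prod_(i < d) (b ord0 i - a ord0 i).

Lemma box_vol_ge0 (R : realType) (d : nat) (a b : 'rV[R]_d) :
  (forall i, a ord0 i <= b ord0 i) -> 0 <= box_vol a b.
Proof. by move=> ab; apply: prodr_ge0 => i _; rewrite subr_ge0. Qed.

Lemma vol_le_cover (R : realType) (d : nat) (A : set 'rV[R]_d)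
    (a b : nat -> 'rV[R]_d) :
  (forall k i, a k ord0 i <= b k ord0 i) ->
  A `<=` \bigcup_k box (a k) (b k) ->
  (vol A <= \sum_(0 <= k <oo) (box_vol (a k) (b k))%:E)%E.
Proof. by move=> ab Aab; apply: ereal_inf_lbound; exists a, b. Qed.

Lemma vol_ge0 (R : realType) (d : nat) (A : set 'rV[R]_d) : (0 <= vol A)%E.
Proof.
apply/ereal_infP => _ [a [b [ab [_ ->]]]].
by apply: nneseries_ge0 => k _ _; rewrite lee_fin; apply: box_vol_ge0.
Qed.

Lemma le_vol (R : realType) (d : nat) (A B : set 'rV[R]_d) :
  A `<=` B -> (vol A <= vol B)%E.
Proof.
move=> AB; apply/ereal_infP => _ [a [b [ab [Bab ->]]]].
by apply: vol_le_cover => //; apply: subset_trans Bab.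
Qed.

(** A cover is an infinite sequence, so the box is followed by degenerate boxes [box a a]; these
    have volume zero because the dimension [d.+1] is positive. *)
Lemma vol_box_le (R : realType) (d : nat) (A : set 'rV[R]_d.+1)
    (a b : 'rV[R]_d.+1) :
  (forall i, a ord0 i <= b ord0 i) -> A `<=` box a b ->
  (vol A <= (box_vol a b)%:E)%E.
Proof.
move=> ab Aab.
pose b' k := if k is 0%N then b else a.
apply: le_trans (@vol_le_cover _ _ _ (fun=> a) b' _ _) _.
- by case.
- by move=> x /Aab ?; exists 0%N.
rewrite nneseries_recl//; last first.
  by move=> [|k] _; rewrite lee_fin; apply: box_vol_ge0.
rewrite eseries0 ?adde0//= => -[|k]// _ _.
by rewrite /box_vol big_ord_recl subrr mul0r.
Qed.

Lemma vol_set0 (R : realType) (d : nat) : vol (set0 : set 'rV[R]_d.+1) = 0%E.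
Proof.
apply/eqP; rewrite eq_le vol_ge0 andbT.
apply: le_trans (@vol_box_le _ _ _ 0 0 _ _) _ => //.
by rewrite /box_vol big_ord_recl subrr mul0r.
Qed.

(** Each [F k] of finite volume gets a cover within [e / 2 ^ k.+1] of optimal; a bijection between
    [nat] and [nat * nat] lists all these boxes as one cover of the union. *)
Lemma vol_sigma_subadditive (R : realType) (d : nat) :
  sigma_subadditive (@vol R d).
Proof.
move=> F; have [[i Fi]|] := pselect (exists i, vol (F i) = +oo%E).
  rewrite (eseries_pinfty _ _ Fi) ?leey// => k _.
  by rewrite -ltNye (lt_le_trans _ (vol_ge0 _)).
rewrite -forallNE => Foo; apply/lee_addgt0Pr => e e0.
apply: le_trans (epsilon_trick xpredT (fun k => vol_ge0 (F k)) (ltW e0)).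
have cov k : exists ab : (nat -> 'rV[R]_d) * (nat -> 'rV[R]_d),
    [/\ forall j i, ab.1 j ord0 i <= ab.2 j ord0 i,
        F k `<=` \bigcup_j box (ab.1 j) (ab.2 j)
      & (\sum_(0 <= j <oo) (box_vol (ab.1 j) (ab.2 j))%:E <=
         vol (F k) + (e / (2 ^ k.+1)%:R)%:E)%E].
  have ek : 0 < e / (2 ^ k.+1)%:R by rewrite divr_gt0// ltr0n expn_gt0.
  have /(lb_ereal_inf_adherent ek) : vol (F k) \is a fin_num.
    rewrite fin_numE -ltNye (lt_le_trans _ (vol_ge0 _))//=.
    exact/eqP/Foo.
  by move=> [_ [a [b [ab [Fab ->]]]] /ltW s]; exists (a, b).
have {cov} [G PG] := choice cov.
pose g (p : nat * nat) : \bar R := (box_vol ((G p.1).1 p.2) ((G p.1).2 p.2))%:E.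
have g0 p : (0 <= g p)%E.
  by rewrite lee_fin; apply: box_vol_ge0 => i; have [+ _ _] := PG p.1; apply.
have /card_esym/ppcard_eqP[f] := card_nat2.
apply: le_trans (@vol_le_cover _ _ _ (fun k => (G (f k).1).1 (f k).2)
  (fun k => (G (f k).1).2 (f k).2) _ _) _.
- by move=> k i; have [+ _ _] := PG (f k).1; apply.
- move=> x [k _ Fx]; have [_ /(_ _ Fx) [j _ bx] _] := PG k.
  by exists (f^-1%FUN (k, j)) => //; rewrite invK ?inE.
rewrite (nneseries_esumT (fun k => g0 (f k))).
rewrite -(@reindex_esum _ _ _ [set: nat] [set: nat * nat] f g)//.
have -> : [set: nat * nat] = setT `*`` (fun=> setT) by apply/seteqP; split.
rewrite -(@esum_esum _ _ _ _ _ (fun k j => g (k, j)))//.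
rewrite -nneseries_esumT; last by move=> k; apply: esum_ge0.
apply: lee_nneseries => [k _ _|k _]; first exact: esum_ge0.
by rewrite -nneseries_esumT//; have [] := PG k.
Qed.

HB.instance Definition _ (R : realType) (d : nat) :=
  isOuterMeasure.Build R 'rV[R]_d.+1 (@vol R d.+1)
    (@vol_set0 R d) (@vol_ge0 R d.+1) (@le_vol R d.+1)
    (@vol_sigma_subadditive R d.+1).

(** The image of a cover by boxes is again a cover by boxes, with all sides multiplied by [r]. *)
Lemma vol_homothety (R : realType) (d : nat) (c : 'rV[R]_d) (r : R)
    (A : set 'rV[R]_d) :
  0 < r -> (vol [set (c + r *: x)%R | x in A] <= (r ^+ d)%:E * vol A)%E.
Proof.
move=> r0; rewrite muleC -lee_pdivrMr ?exprn_gt0//.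
apply/ereal_infP => _ [a [b [ab [Aab ->]]]].
rewrite lee_pdivrMr ?exprn_gt0// muleC -nneseriesZl; last first.
  by move=> k _; rewrite lee_fin; apply: box_vol_ge0.
apply: le_trans (@vol_le_cover _ _ _ (fun k => c + r *: a k)
  (fun k => c + r *: b k) _ _) _.
- by move=> k i; rewrite !mxE lerD2l ler_pM2l.
- move=> _ [x /Aab[k _ bx] <-]; exists k => // i; rewrite !mxE.
  by rewrite !lerD2l !ler_pM2l.
apply: lee_nneseries => [k _ _|k _].
  by rewrite lee_fin box_vol_ge0// => i; rewrite !mxE lerD2l ler_pM2l.
rewrite -EFinM lee_fin /box_vol -[d in r ^+ d]card_ord -prodr_const -big_split/=.
apply: ler_prod => i _; rewrite !mxE opprD addrACA subrr add0r -mulrBr lexx andbT.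
by rewrite mulr_ge0 ?(ltW r0)// subr_ge0.
Qed.

(* Halving a side of the box halves its volume, and once the box is smaller
   than the separation it meets only one of the two sets. *)
Lemma vol_separated_box (R : realType) (d : nat) (P Q : set 'rV[R]_d.+1)
    (eta : R) (m : 'I_d.+1 -> nat) (a b : 'rV[R]_d.+1) :
  (forall p q, P p -> Q q -> exists i, eta <= `|p ord0 i - q ord0 i|) ->
  (forall i, a ord0 i <= b ord0 i) ->
  (forall i, b ord0 i - a ord0 i < 2 ^+ m i * eta) ->
  (vol (P `&` box a b) + vol (Q `&` box a b) <= (box_vol a b)%:E)%E.
Proof.
(* Induction on the total number [k] of halvings left; when it is zero, every side is shorter than
   [eta]. *)
move=> sepPQ; move k_def : (\sum_i m i)%N => k.
elim: k m k_def a b => [|k IHk] m mk a b ab abm.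
  have m0 i : m i = 0%N.
    by move/eqP: mk; rewrite sum_nat_eq0 => /forallP/(_ i)/eqP.
  have [[p [Pp bp]]|] := pselect (exists p, P p /\ box a b p).
    rewrite (_ : Q `&` _ = set0) ?vol_set0 ?adde0.
      by apply: vol_box_le => // x [].
    rewrite -subset0 => q [Qq bq]; have [i] := sepPQ _ _ Pp Qq.
    apply/negP; rewrite -ltNge; have := abm i; rewrite m0 expr0 mul1r.
    have /andP[? ?] := bp i; have /andP[? ?] := bq i.
    by move=> ?; rewrite ltr_norml; apply/andP; split; lra.
  move=> nP; rewrite (_ : P `&` _ = set0) ?vol_set0 ?add0e.
    by apply: vol_box_le => // x [].
  by rewrite -subset0 => p [? ?]; apply: nP; exists p.
have [j mj] : exists j, (0 < m j)%N.
  apply/existsP; rewrite -[X in is_true X]negbK negb_exists; apply/negP => /forallP m0.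
  move: mk; rewrite big1// => i _; have := m0 i; rewrite -eqn0Ngt => /eqP//.
pose c := (a ord0 j + b ord0 j) / 2.
pose m' i := if i == j then (m j).-1 else m i.
have m'k : (\sum_i m' i)%N = k.
  move: mk; rewrite (bigD1 j)//= (bigD1 j (F := m'))//= /m' eqxx => mk.
  rewrite (eq_bigr m) => [|i /negbTE->//].
  by move: mk; case: (m j) mj => // mj' _ [].
pose b1 : 'rV[R]_d.+1 := \row_i (if i == j then c else b ord0 i).
pose a2 : 'rV[R]_d.+1 := \row_i (if i == j then c else a ord0 i).
have abj := ab j.
have ab1 i : a ord0 i <= b1 ord0 i.
  by rewrite mxE; case: eqP => [->|//]; rewrite /c; lra.
have ab2 i : a2 ord0 i <= b ord0 i.
  by rewrite mxE; case: eqP => [->|//]; rewrite /c; lra.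
have pow_mj : 2 ^+ m j = 2 * 2 ^+ (m j).-1 :> R by rewrite -exprS prednK.
have abmj := abm j; rewrite pow_mj in abmj.
have ab1m i : b1 ord0 i - a ord0 i < 2 ^+ m' i * eta.
  rewrite mxE /m'; case: eqP => [->|//].
  by rewrite /c; move: abmj; rewrite -mulrA; set z := _ * eta; lra.
have ab2m i : b ord0 i - a2 ord0 i < 2 ^+ m' i * eta.
  rewrite mxE /m'; case: eqP => [->|//].
  by rewrite /c; move: abmj; rewrite -mulrA; set z := _ * eta; lra.
have box_split : box a b `<=` box a b1 `|` box a2 b.
  move=> x bx; have [xc|/ltW cx] := leP (x ord0 j) c; [left|right] => i;
    rewrite mxE; have := bx i; case: eqP => [->|//] /andP[? ?]; lra.
have vol_split : box_vol a b1 + box_vol a2 b = box_vol a b.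
  have D1 (u v : 'rV[R]_d.+1) : box_vol u v = (v ord0 j - u ord0 j) *
      \prod_(i < d.+1 | i != j) (v ord0 i - u ord0 i) by rewrite /box_vol (bigD1 j).
  rewrite !D1 !mxE eqxx.
  under eq_bigr => i /negbTE ij do rewrite mxE ij.
  under [X in _ + _ * X = _]eq_bigr => i /negbTE ij do rewrite mxE ij.
  by rewrite -mulrDl /c; congr (_ * _); lra.
have volI (A : set 'rV[R]_d.+1) : (vol (A `&` box a b) <=
    vol (A `&` box a b1) + vol (A `&` box a2 b))%E.
  apply: le_trans (outer_measureU2 _ _ _); apply: le_vol.
  by rewrite -setIUr; apply: setIS.
rewrite -vol_split EFinD.
apply: le_trans (leeD (volI P) (volI Q)) _.
by rewrite addeACA; apply: leeD; apply: (IHk m').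
Qed.

(** Any cover of the union is split box by box: inside each box the parts of [P] and [Q] share its
    volume. The number of halvings may depend on the box, while [eta] does not. *)
Lemma vol_separated (R : realType) (d : nat) (P Q : set 'rV[R]_d.+1) (eta : R) :
  0 < eta ->
  (forall p q, P p -> Q q -> exists i, eta <= `|p ord0 i - q ord0 i|) ->
  (vol P + vol Q <= vol (P `|` Q))%E.
Proof.
move=> eta0 sepPQ; apply/ereal_infP => _ [a [b [ab [PQab ->]]]].
have cov (A : set 'rV[R]_d.+1) : A `<=` P `|` Q ->
    (vol A <= \sum_(0 <= k <oo) vol (A `&` box (a k) (b k)))%E.
  move=> APQ; apply: le_trans (vol_sigma_subadditive _); apply: le_vol.
  by move=> x Ax; have [k _ bx] := PQab _ (APQ _ Ax); exists k.
apply: le_trans (leeD (cov P _) (cov Q _)) _ => //.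
rewrite -nneseriesD; try by move=> *; apply: vol_ge0.
apply: lee_nneseries => [k _ _|k _]; first by rewrite adde_ge0 ?vol_ge0.
have big i : exists m, b k ord0 i - a k ord0 i < 2 ^+ m * eta.
  exists (Num.bound `|(b k ord0 i - a k ord0 i) / eta|).
  rewrite -ltr_pdivrMr//; apply: le_lt_trans (ler_norm _) _.
  apply: lt_trans (archi_boundP (normr_ge0 _)) _.
  by rewrite -natrX ltr_nat ltn_expl.
have [m abm] := choice big.
exact: vol_separated_box abm.
Qed.

Lemma vol_bigcup_fin (R : realType) (d : nat) (I : finType)
    (F : I -> set 'rV[R]_d.+1) :
  (vol (\bigcup_i F i) <= \sum_i vol (F i))%E.
Proof.
have -> : \bigcup_i F i = \big[setU/set0]_i F i.
  rewrite -bigcup_seq; apply: eq_bigcupl; split => // i _ /=.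
  exact: mem_index_enum.
apply: (big_ind2 (fun A x => (vol A <= x)%E)) => //.
  by rewrite vol_set0.
by move=> A x B y Ax By; apply: le_trans (outer_measureU2 _ _ _) (leeD Ax By).
Qed.

(** * Inner products and extreme points of polytopes *)

Definition dot (R : realType) (d : nat) (x y : 'rV[R]_d) : R :=
  \sum_(i < d) x ord0 i * y ord0 i.

Lemma dotC (R : realType) (d : nat) (x y : 'rV[R]_d) : dot x y = dot y x.
Proof. by apply: eq_bigr => i _; rewrite mulrC. Qed.

Lemma dotDl (R : realType) (d : nat) (x y z : 'rV[R]_d) :
  dot (x + y) z = dot x z + dot y z.
Proof. by rewrite -big_split; apply: eq_bigr => i _; rewrite mxE mulrDl. Qed.

Lemma dotZl (R : realType) (d : nat) (c : R) (x z : 'rV[R]_d) :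
  dot (c *: x) z = c * dot x z.
Proof. by rewrite mulr_sumr; apply: eq_bigr => i _; rewrite mxE mulrA. Qed.

Lemma dotDr (R : realType) (d : nat) (x y z : 'rV[R]_d) :
  dot z (x + y) = dot z x + dot z y.
Proof. by rewrite dotC dotDl !(dotC z). Qed.

Lemma dotZr (R : realType) (d : nat) (c : R) (x z : 'rV[R]_d) :
  dot z (c *: x) = c * dot z x.
Proof. by rewrite dotC dotZl (dotC z). Qed.

Lemma dotBl (R : realType) (d : nat) (x y z : 'rV[R]_d) :
  dot (x - y) z = dot x z - dot y z.
Proof. by rewrite dotDl -scaleN1r dotZl mulN1r. Qed.

Lemma dotBr (R : realType) (d : nat) (x y z : 'rV[R]_d) :
  dot z (x - y) = dot z x - dot z y.
Proof. by rewrite dotC dotBl !(dotC z). Qed.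

Lemma dot_suml (R : realType) (d m : nat) (f : 'I_m -> 'rV[R]_d) (z : 'rV[R]_d) :
  dot (\sum_j f j) z = \sum_j dot (f j) z.
Proof.
by rewrite exchange_big; apply: eq_bigr => i _; rewrite summxE mulr_suml.
Qed.

Lemma sqr_coord_le_dot (R : realType) (d : nat) (x : 'rV[R]_d) (i : 'I_d) :
  (x ord0 i) ^+ 2 <= dot x x.
Proof.
rewrite expr2 /dot (bigD1 i)//= lerDl; apply: sumr_ge0 => j _.
by rewrite -expr2 sqr_ge0.
Qed.

Lemma dot_ge0 (R : realType) (d : nat) (x : 'rV[R]_d) : 0 <= dot x x.
Proof. by apply: sumr_ge0 => j _; rewrite -expr2 sqr_ge0. Qed.

Lemma dot_le0 (R : realType) (d : nat) (x : 'rV[R]_d) : dot x x <= 0 -> x = 0.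
Proof.
move=> x0; apply/rowP => i; rewrite mxE; apply/eqP.
by rewrite -sqrf_eq0 eq_le sqr_ge0 andbT (le_trans (sqr_coord_le_dot _ _)).
Qed.

Lemma unit_ballE (R : realType) (d : nat) (x : 'rV[R]_d) :
  unit_ball x = (dot x x <= 1) :> Prop.
Proof. by rewrite /dot /unit_ball /=; under eq_bigr do rewrite expr2. Qed.

Lemma vol_unit_ball_fin_num (R : realType) (d : nat) :
  vol (@unit_ball R d.+1) \is a fin_num.
Proof.
rewrite ge0_fin_numE ?vol_ge0//.
apply: le_lt_trans (@vol_box_le _ _ _ (const_mx (-1)) (const_mx 1) _ _) (ltry _).
  by move=> i; rewrite !mxE; lra.
move=> x; rewrite unit_ballE => xB i; rewrite !mxE -ler_norml.
rewrite -(@ler_pXn2r _ 2) ?nnegrE// expr1n real_normK ?num_real//.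
exact: le_trans (sqr_coord_le_dot _ _) xB.
Qed.

(* Among the generators maximising [dot _ u], one of largest norm is extreme:
   the norm is strictly convex. *)
Lemma polytope_vertex_ge (R : realType) (d : nat) (P : set 'rV[R]_d)
    (y u : 'rV[R]_d) :
  is_polytope P -> P y -> exists2 v, vertices P v & dot y u <= dot v u.
Proof.
move=> [m [p ->]] Py; set H := conv_hull _ in Py *.
have [j0 _] : exists j : 'I_m, True.
  move: Py => [[|k] [w [a [pa [_ [w1 _]]]]]].
    by move: w1; rewrite big_ord0 => /esym/eqP; rewrite oner_eq0.
  by have [j _ _] := pa ord0; exists j.
have [j1 _ j1max] := arg_maxP (fun j => dot (p j) u) (isT : xpredT j0).
have [j2 /eqP j2u j2max] := arg_maxP (P := fun j => dot (p j) u == dot (p j1) u)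
  (fun j => dot (p j) (p j)) (eqxx _).
set v := p j2 in j2u j2max.
have pu j : dot (p j) u <= dot v u by rewrite j2u; exact: j1max.
have pv j : dot (p j) u = dot v u -> dot (p j) (p j) <= dot v v.
  by move=> ju; apply: j2max; rewrite ju j2u.
have Hu z : H z -> dot z u <= dot v u.
  move=> [k [w [a [pa [w0 [w1 ->]]]]]].
  rewrite dot_suml -[leRHS]mul1r -w1 mulr_suml; apply: ler_sum => j _.
  by rewrite dotZl ler_wpM2l//; have [i _ <-] := pa j; exact: pu.
(* If [z] maximises [dot _ u], so does every [a j] of nonzero weight, whence |a j| <= |v|. Averaging
   2 <a j, z> <= |z|^2 + |a j|^2 then gives 2 |z|^2 <= |z|^2 + |v|^2. *)
have Hv z : H z -> dot z u = dot v u -> dot z z <= dot v v.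
  move=> [k [w [a [pa [w0 [w1 zE]]]]]] zu.
  have wau j : w j * (dot v u - dot (a j) u) = 0.
    have S0 : \sum_j w j * (dot v u - dot (a j) u) = 0.
      under eq_bigr do rewrite mulrBr.
      rewrite sumrB -mulr_suml w1 mul1r -zu zE dot_suml.
      by under [X in _ - X]eq_bigr do rewrite -dotZl; rewrite subrr.
    apply: (psumr_eq0P _ S0) => // i _; rewrite mulr_ge0// subr_ge0.
    by have [l _ <-] := pa i; exact: pu.
  have wav j : w j * dot (a j) (a j) <= w j * dot v v.
    have /eqP := wau j; rewrite mulf_eq0 subr_eq0 => /orP[/eqP->|/eqP au].
      by rewrite !mul0r.
    by rewrite ler_wpM2l//; have [l _ lE] := pa j; rewrite -lE pv// lE.
  have waz j : 2 * (w j * dot (a j) z) <= w j * dot z z + w j * dot v v.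
    apply: le_trans (lerD (lexx _) (wav j)).
    rewrite mulrCA -mulrDr ler_wpM2l//.
    by have := dot_ge0 (z - a j); rewrite dotBl !dotBr (dotC z (a j)); lra.
  have : \sum_j 2 * (w j * dot (a j) z) <= \sum_j (w j * dot z z + w j * dot v v).
    by apply: ler_sum => j _; apply: waz.
  rewrite -mulr_sumr big_split/= -!mulr_suml w1 !mul1r.
  under eq_bigr do rewrite -dotZl.
  by rewrite -dot_suml -zE; lra.
have Hpv : H v.
  exists 1%N, (fun=> 1), (fun=> v); split; first by move=> _; exists j2.
  by rewrite !big_ord1 scale1r.
exists v; last exact: Hu.
split => // -[a [b [t [Ha [Hb [ab [/andP[t0 t1] vE]]]]]]].
have au := Hu _ Ha; have bu := Hu _ Hb.
have vu : dot v u = t * dot a u + (1 - t) * dot b u.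
  by rewrite {1}vE dotDl !dotZl.
have aE : dot a u = dot v u by apply/eqP; rewrite eq_le au/=; nra.
have bE : dot b u = dot v u by apply/eqP; rewrite eq_le bu/=; nra.
have av := Hv _ Ha aE; have bv := Hv _ Hb bE.
(* Since |a| and |b| are at most |v|, this identity forces t (1 - t) |a - b|^2 <= 0, hence
   [a = b]. *)
have vv : dot v v = t * dot a a + (1 - t) * dot b b
                    - t * (1 - t) * dot (a - b) (a - b).
  by rewrite vE !(dotBl, dotBr, dotDl, dotDr, dotZl, dotZr) (dotC b a); ring.
move/eqP: ab; apply; apply/subr0_eq/dot_le0.
have tt : 0 < t * (1 - t) by nra.
rewrite -(pmulr_rle0 _ tt); nra.
Qed.

(** * Volume of the cones and of the shell outside them *)

(** The inequality is homogeneous in [y], so inside the ball membership is unaffected by positive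
    scaling; this makes the complement of the cones star-shaped. *)
Definition cone (R : realType) (d : nat) (x : 'rV[R]_d) (t : R) : set 'rV[R]_d :=
  [set y | unit_ball y /\ (1 - t) * Num.sqrt (dot y y) < dot x y].

(* A point [y] of the cone is within [s] of [|y| x], so balls of radius [2 s]
   centred at the multiples of [s x] cover the cone. *)
Lemma vol_cone_le (R : realType) (d : nat) (x : 'rV[R]_d.+1) (s : R) :
  unit_ball x -> 0 < s <= 1 ->
  (vol (cone x (s ^+ 2 / 2)) <=
   (4 * (2 * s) ^+ d)%:E * vol (@unit_ball R d.+1))%E.
Proof.
(* The centre for [y] is [(k%:R * s) *: x] with k the integer part of |y| / s, which is at most 1 /
   s. *)
rewrite unit_ballE => x1 /andP[s0 s1].
pose K := (Num.truncn s^-1).+1.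
pose ball (k : 'I_K) := [set (k%:R * s) *: x + (2 * s) *: b | b in @unit_ball R d.+1].
have cover : cone x (s ^+ 2 / 2) `<=` \bigcup_k ball k.
  move=> y; rewrite /cone /= unit_ballE => -[y1]; set l := Num.sqrt _ => xy.
  have l0 : 0 <= l := sqrtr_ge0 _.
  have l2 : dot y y = l ^+ 2 by rewrite sqr_sqrtr// dot_ge0.
  have l1 : l <= 1 by nra.
  have ls0 : 0 <= l / s by rewrite divr_ge0// ltW.
  have kK : (Num.truncn (l / s) < K)%N.
    by rewrite ltnS le_truncn// ler_pdivrMr// mulVf// gt_eqF.
  exists (Ordinal kK) => //=.
  have /andP[] := truncn_itv ls0.
  set k := (Num.truncn _)%:R; rewrite -natr1 -/k => kl lk.
  rewrite ler_pdivlMr// in kl; rewrite ltr_pdivrMr// in lk.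
  pose b := (2 * s)^-1 *: (y - (k * s) *: x).
  exists b; last first.
    by rewrite scalerA divff ?scale1r 1?addrC ?subrK// gt_eqF// mulr_gt0.
  rewrite unit_ballE /b dotZl dotZr mulrA -expr2 exprVn mulrC ler_pdivrMr ?mul1r;
    last by rewrite exprn_gt0// mulr_gt0.
  pose e := l - k * s.
  (* Both summands have norm at most [s]: the first by the cone condition, the second by the
     rounding of |y| / s. So the sum has norm at most [2 * s]. *)
  have -> : y - (k * s) *: x = (y - l *: x) + e *: x.
    by rewrite /e scalerBl addrA subrK.
  have u2 : dot (y - l *: x) (y - l *: x) <= s ^+ 2.
    rewrite dotBl !dotBr !dotZl !dotZr (dotC y x) l2.
    have : l * l * dot x x <= l * l by rewrite -[leRHS]mulr1 ler_wpM2l ?mulr_ge0.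
    have : l * ((1 - s ^+ 2 / 2) * l) <= l * dot x y by rewrite ler_wpM2l// ltW.
    have : l ^+ 2 * s ^+ 2 <= s ^+ 2.
      by rewrite -[leRHS]mul1r ler_wpM2r ?sqr_ge0//; nra.
    by rewrite !expr2; nra.
  have v2 : dot (e *: x) (e *: x) <= s ^+ 2.
    rewrite dotZl dotZr mulrA; have e0 : 0 <= e by rewrite subr_ge0.
    have es : e <= s by rewrite /e; lra.
    have : e * e * dot x x <= e * e by rewrite -[leRHS]mulr1 ler_wpM2l ?mulr_ge0.
    by nra.
  move: (y - l *: x) (e *: x) u2 v2 => u v u2 v2.
  have := dot_ge0 (u - v); rewrite dotBl !dotBr dotDl !dotDr (dotC v u).
  by rewrite exprMn; lra.
apply: le_trans (le_vol cover) _; apply: le_trans (vol_bigcup_fin _) _.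
apply: le_trans (lee_sum _ _) _ => [k _|].
  by apply: vol_homothety; rewrite mulr_gt0.
have fB := vol_unit_ball_fin_num R d; rewrite -(fineK fB) -!EFinM.
rewrite sumEFin sumr_const card_ord -(mulr_natl _ K) lee_fin mulrA.
rewrite ler_wpM2r ?fine_ge0 ?vol_ge0// exprS.
(* The number of balls absorbs one of the [d.+1] factors [2 * s], since K s <= 1 + s <= 2. *)
have K2 : K%:R * (2 * s) <= 4.
  have si0 : 0 <= s^-1 by rewrite invr_ge0 ltW.
  have /andP[Ks _] := truncn_itv si0.
  have := ler_wpM2r (ltW s0) Ks; rewrite mulVf ?gt_eqF// => Ks1.
  by rewrite /K -natr1; nra.
by rewrite mulrA ler_wpM2r// exprn_ge0// mulr_ge0// ltW.
Qed.

(* [Q] is the part of the outer shell of the ball lying outside all cones; it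
   is separated from [P], and rescaling the complement of the cones bounds its
   volume from below. *)
Lemma vol_deficit (R : realType) (d n : nat) (P : set 'rV[R]_d.+1)
    (x : 'I_n -> 'rV[R]_d.+1) (s : R) :
  P `<=` @unit_ball R d.+1 ->
  (forall i, unit_ball (x i)) ->
  (forall y u, P y -> exists i, dot y u <= dot (x i) u) ->
  0 < s <= 1 -> n%:R * (4 * (2 * s) ^+ d) <= 1 / 2 ->
  (vol P + ((1 - (1 - s ^+ 2 / 4) ^+ d.+1) / 2)%:E * vol (@unit_ball R d.+1)
     <= vol (@unit_ball R d.+1))%E.
Proof.
move=> PB x1 Px s01 ns; have /andP[s0 s1] := s01.
set B := @unit_ball R d.+1; pose rho := 1 - s ^+ 2 / 4.
pose t := s ^+ 2 / 2.
have s2 : 0 < s ^+ 2 <= 1 by rewrite exprn_gt0//= expr_le1// ltW.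
have rho0 : 0 < rho by rewrite /rho; lra.
pose A := \bigcup_i cone (x i) t.
pose Q := (B `\` A) `&` [set y | rho < Num.sqrt (dot y y)].
have fB : vol B \is a fin_num := vol_unit_ball_fin_num R d.
have fin (E : set 'rV[R]_d.+1) : E `<=` B -> vol E \is a fin_num.
  move=> EB; rewrite ge0_fin_numE ?vol_ge0//.
  by apply: le_lt_trans (le_vol EB) _; rewrite -ge0_fin_numE ?vol_ge0.
have AB : A `<=` B by move=> y [i _ []].
have QB : Q `<=` B by move=> y [[]].
have volA : (vol A <= (1 / 2)%:E * vol B)%E.
  apply: le_trans (vol_bigcup_fin _) _.
  apply: le_trans (lee_sum _ (fun i _ => vol_cone_le (x1 i) s01)) _.
  rewrite -/B -(fineK fB) -!EFinM sumEFin sumr_const card_ord.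
  rewrite lee_fin -(mulr_natl _ n) mulrA.
  by rewrite ler_wpM2r// fine_ge0// vol_ge0.
have volD : (vol B <= vol A + vol (B `\` A))%E.
  apply: le_trans (outer_measureU2 _ _ _); apply: le_vol => y By.
  by have [?|?] := pselect (A y); [left|right].
(* A point of [B \ A] of norm at most [rho] is [rho] times a point that is still in the ball and, by
   homogeneity, still outside every cone. *)
have volDQ : (vol (B `\` A) <= vol Q + (rho ^+ d.+1)%:E * vol (B `\` A))%E.
  apply: le_trans (leeD (lexx _) (vol_homothety 0 (B `\` A) rho0)).
  apply: le_trans (outer_measureU2 _ _ _); apply: le_vol => y BAy.
  have [|yr] := ltP rho (Num.sqrt (dot y y)); first by left.
  right; exists (rho^-1 *: y); last by rewrite scalerA divff ?gt_eqF// scale1r add0r.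
  have norm_scale : Num.sqrt (dot (rho^-1 *: y) (rho^-1 *: y)) =
      rho^-1 * Num.sqrt (dot y y).
    rewrite dotZl dotZr mulrA -expr2 sqrtrM ?sqr_ge0// sqrtr_sqr ger0_norm//.
    by rewrite invr_ge0 ltW.
  split.
    rewrite /B unit_ballE -[leLHS]sqr_sqrtr ?dot_ge0// norm_scale.
    by rewrite expr_le1// ?mulr_ge0 ?invr_ge0 ?sqrtr_ge0 ?(ltW rho0)//
      mulrC ler_pdivrMr// mul1r.
  move=> [i _ [_]]; rewrite norm_scale dotZr mulrCA ltr_pM2l ?invr_gt0// => yi.
  by apply: BAy.2; exists i => //; split => //; exact: BAy.1.
have volPQ : (vol P + vol Q <= vol B)%E.
  (* If all coordinates of [p] and [q] differed by less than [eta], then <q - p, q> < (s^2 / 4) |q|.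
     But |q| > rho and <p, q> <= (1 - t) |q| give <q - p, q> > (rho - 1 + t) |q|, where rho - 1 + t
     = s^2 / 4. *)
  pose eta := s ^+ 2 / 4 / d.+1%:R.
  apply: (@le_trans _ _ (vol (P `|` Q))); last first.
    by apply: le_vol => y [/PB|/QB].
  apply: (@vol_separated _ _ _ _ eta); first by rewrite !divr_gt0 ?exprn_gt0.
  move=> p q Pp [[Bq Aq] /= qr]; apply: contrapT => /forallNP small.
  pose l := Num.sqrt (dot q q).
  have l0 : 0 < l by apply: lt_trans qr.
  have l2 : dot q q = l ^+ 2 by rewrite sqr_sqrtr// dot_ge0.
  have pq : dot p q <= (1 - t) * l.
    have [i /le_trans] := Px _ q Pp; apply; rewrite leNgt; apply/negP => xq.
    by apply: Aq; exists i.
  have : dot (q - p) q < s ^+ 2 / 4 * l.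
    have -> : s ^+ 2 / 4 * l = \sum_(i < d.+1) eta * l.
      by rewrite sumr_const card_ord -(mulr_natl _ d.+1) mulrA mulrCA divff ?mulr1.
    apply: ltr_sum; first by apply/hasP; exists ord0 => //; exact: mem_index_enum.
    move=> i _; rewrite !mxE.
    have qi : `|q ord0 i| <= l by rewrite -sqrtr_sqr ler_wsqrtr// sqr_coord_le_dot.
    apply: le_lt_trans (ler_norm _) _; rewrite normrM.
    have := small i; rewrite distrC => /negP; rewrite -ltNge => small_i.
    apply: le_lt_trans (ler_wpM2l (normr_ge0 _) qi) _.
    by rewrite ltr_pM2r.
  rewrite dotBl l2.
  have : rho * l < l ^+ 2 by rewrite expr2 ltr_pM2r.
  by rewrite /rho; move: pq; rewrite /t; lra.
move: volA volD volDQ volPQ.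
rewrite -(fineK fB) -(fineK (fin _ AB)) -(fineK (fin _ PB)) -(fineK (fin _ QB)).
rewrite -(fineK (fin _ (@subDsetl _ B A))) -!EFinM -!EFinD !lee_fin.
have rho1 : rho ^+ d.+1 <= 1 by rewrite exprn_ile1 ?(ltW rho0)// /rho; lra.
rewrite -/rho; set r := rho ^+ _ in rho1 *.
move: (fine _) (fine _) (fine _) (fine _) (fine _) => b a g q p aB BD DQ PQ.
(* vol (B \ A) is at least half of vol B, and vol Q >= (1 - r) vol (B \ A). *)
by nra.
Qed.

(** * A numerical estimate and the choice of constants *)

(** Induction gives (1 - x)^n <= 1 / (1 + n x), and 1 / (1 + y) <= 1 - y / 2 for y in [0, 1]. It
    makes the relative volume of the shell of order d t. *)
Lemma bernoulli_upper (R : realFieldType) (x : R) (n : nat) :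
  0 <= x <= 1 -> n%:R * x <= 1 -> (1 - x) ^+ n <= 1 - n%:R * x / 2.
Proof.
move=> /andP[x0 x1] nx1.
have inv k : (1 - x) ^+ k * (1 + k%:R * x) <= 1.
  elim: k => [|k IHk]; first by rewrite mul0r addr0 mulr1.
  apply: le_trans IHk; rewrite exprSr -mulrA ler_wpM2l ?exprn_ge0 ?subr_ge0//.
  have : 0 <= k%:R :> R by [].
  by rewrite -natr1; nra.
have := inv n; set y := n%:R * x in nx1 *; set z := _ ^+ n.
have y0 : 0 <= y by rewrite mulr_ge0.
have : 0 <= z by rewrite exprn_ge0// subr_ge0.
by nra.
Qed.

Unset Implicit Arguments.

Theorem theorem1 (R : realType) :
  exists c1 c2 : R, 0 < c1 /\ 0 < c2 /\
  forall (d n : nat), (2 <= d)%N ->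
    (c1 * d%:R) `^ ((d%:R - 1) / 2) <= n%:R ->
    forall P : set 'rV[R]_d,
      is_polytope P -> P `<=` @unit_ball R d -> has_n_vertices P n ->
      (vol (@unit_ball R d) - vol P >=
        (c2 * d%:R * n%:R `^ (- (2 / (d%:R - 1))))%:E * vol (@unit_ball R d))%E.
Proof.
(* With s = r / 16, s^2 / 4 = r^2 / 1024; the estimate of the power and the half lost to the cones
   each cost a factor 2, leaving r^2 / 4096 = r^2 / 8^4. *)
exists 1, (8^-1 ^+ 4); split; first exact: ltr01.
split; first by rewrite exprn_gt0 ?invr_gt0.
(* From here on the dimension is [d.+1], with [d] positive, and the exponents are d / 2 and - 2 /
   d. *)
move=> [//|d] n d1 dn P polP PB [x [_ xV]].
have dR : d.+1%:R - 1 = d%:R :> R by rewrite -natr1 addrK.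
rewrite mul1r dR in dn *.
have d0 : 0 < d%:R :> R by rewrite ltr0n.
have n0 : 0 < n%:R :> R by apply: lt_le_trans dn; rewrite powR_gt0.
have nn0 : n%:R != 0 :> R by rewrite gt_eqF.
pose r : R := n%:R `^ (- d%:R^-1).
have r0 : 0 < r by rewrite powR_gt0.
have rd : r ^+ d = n%:R^-1.
  by rewrite -powR_mulrn ?ltW// -powRrM mulNr mulVf ?gt_eqF// powR_inv1 ?ltW.
have r2 : n%:R `^ (- (2 / d%:R)) = r ^+ 2.
  by rewrite -powR_mulrn ?ltW// -powRrM mulNr mulrC.
have r1 : r <= 1.
  rewrite -(@expr_le1 _ d _ d1 (ltW r0)) rd invf_le1// -[leLHS]/(1%:R) ler_nat.
  by rewrite -(ltr0n R).
(* Raising the lower bound on [n] to the power 2 / d gives d + 1 <= n^(2/d) = r^(-2), which yields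
   the smallness condition of [bernoulli_upper]. *)
have dr2 : d.+1%:R * r ^+ 2 <= 1.
  rewrite -r2 powRN ler_pdivrMr ?powR_gt0// mul1r.
  have := @ge0_ler_powR R (2 / d%:R) _ _ _ _ _ dn.
  rewrite -powRrM mulrA divfK// divff ?gt_eqF// powRr1//.
  by apply; rewrite ?nnegrE ?powR_ge0 ?divr_ge0// ltW.
rewrite r2 -/r.
have xB i : unit_ball (x i).
  by have [/PB] : vertices P (x i) by rewrite -xV; exists i.
have Px y u : P y -> exists i, dot y u <= dot (x i) u.
  move=> /(polytope_vertex_ge u polP)[v + yv]; rewrite -xV => -[i _ vE].
  by exists i; rewrite vE.
have s01 : 0 < r / 16 <= 1 by apply/andP; split; lra.
(* As r^d = 1 / n, the left side equals 4 / 8^d, at most 1 / 2 because d >= 1; this dictates the 16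
   in [r / 16]. *)
have ns : n%:R * (4 * (2 * (r / 16)) ^+ d) <= 1 / 2.
  have -> : 2 * (r / 16) = r * 8^-1 by field.
  rewrite exprMn rd mulrCA (mulrA n%:R) divff// mul1r.
  have : (8^-1) ^+ d <= 8^-1 :> R by rewrite -[leRHS]expr1 ler_wiXn2l//; lra.
  lra.
have := vol_deficit PB xB Px s01 ns.
have fB := vol_unit_ball_fin_num R d.
have fP : vol P \is a fin_num.
  rewrite ge0_fin_numE ?vol_ge0//.
  by apply: le_lt_trans (le_vol PB) _; rewrite -ge0_fin_numE ?vol_ge0.
have x01 : 0 <= (r / 16) ^+ 2 / 4 <= 1.
  rewrite expr2; apply/andP; split; nra.
have dx1 : d.+1%:R * ((r / 16) ^+ 2 / 4) <= 1.
  rewrite exprMn; move: dr2; have : 0 <= d.+1%:R * r ^+ 2 by rewrite mulr_ge0 ?sqr_ge0.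
  by rewrite !mulrA; set z := d.+1%:R * _; lra.
have := bernoulli_upper x01 dx1.
rewrite -(fineK fB) -(fineK fP) -!EFinM -EFinD -EFinB !lee_fin.
have : 0 <= fine (vol (@unit_ball R d.+1)) by rewrite fine_ge0// vol_ge0.
move: (fine _) (fine _) => p b b0; set X := (1 - _) ^+ _ => bern defi.
have : (1 - X) / 2 * b >= (d.+1%:R * ((r / 16) ^+ 2 / 4) / 2) / 2 * b.
  by apply: ler_wpM2r => //; lra.
have -> : d.+1%:R * ((r / 16) ^+ 2 / 4) / 2 / 2 = 8^-1 ^+ 4 * d.+1%:R * r ^+ 2.
  by field.
lra.
Qed.
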